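(* Let $V_1,\ldots,V_m$ (with $V_1\ge V_j$ for all $j\ge 2$) be the total precipitation volumes during $m$ wet periods. Under the hypothesis $H_0$ (``the precipitation volume $V_1$ under consideration is not abnormally large'') the random variable $$SR_{GG}=\frac{(m-1)V_1^\gamma}{V_2^\gamma+\ldots+V_m^\gamma}$$ has the Snedecor--Fisher distribution with parameters $r$ and $k=(m-1)r$. Let $q_{r,k}(1-\alpha)$ be the $(1-\alpha)$-quantile of the corresponding Snedecor--Fisher distribution, where $\alpha\in(0,1)$ is a small number. If $SR_{GG}>q_{r,k}(1-\alpha)$, then the hypothesis $H_0$ must be rejected.
   Context: Total precipitation volumes during wet periods are modelled by the generalized gamma distribution with parameters $r>0$, $\gamma\neq 0$ real, $\mu>0$, which has density $g^*(x;r,\gamma,\mu)=\frac{|\gamma|\mu^r}{\Gamma(r)}x^{\gamma r-1}e^{-\mu x^\gamma}$, $x\ge 0$; here $m\ge 2$ is an integer. The hypothesis $H_0$ that $V_1$ is not abnormally large is formulated as the homogeneity hypothesis for a sample from this distribution: $V_1,\ldots,V_m$ are treated as independent random variables with the same generalized gamma distribution with parameters $r,\gamma,\mu$. For $r,k>0$, the Snedecor--Fisher distribution with parameters $r$ and $k$ is the distribution of $Q_{r,k}=\frac{k\,G_{r,1}}{r\,G_{k,1}}$, where $G_{r,1}$ and $G_{k,1}$ are independent gamma random variables with densities $\frac{1}{\Gamma(r)}x^{r-1}e^{-x}$ and $\frac{1}{\Gamma(k)}x^{k-1}e^{-x}$, $x>0$ (so the parameters are gamma shape parameters). Rejecting $H_0$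 means that $V_1$ must be regarded as abnormally large; the number $\alpha$ is the significance level, i.e. the paper states that the probability of erroneous rejection of $H_0$ is equal to $\alpha$. *)

(* Defs.v *)
(* MathComp-Analysis *)
From mathcomp Require Export all_boot all_order all_algebra.
From mathcomp Require Export finmap all_classical all_reals all_analysis.

Set Implicit Arguments.
Unset Strict Implicit.
Unset Printing Implicit Defensive.

Import Order.TTheory GRing.Theory Num.Theory.
Import numFieldNormedType.Exports.

Local Open Scope classical_set_scope.
Local Open Scope ring_scope.

Section laws.
Context {R : realType}.

Definition density_law (f : R -> R) (A : set R) : \bar R :=
  (\int[lebesgue_measure]_(x in A) (f x)%:E)%E.

Definition has_law d (T : measurableType d) (P : probability T R)
    (X : T -> R) (nu : set R -> \bar R) : Prop :=
  measurable_fun [set: T] X /\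
  forall A : set R, measurable A -> pushforward P X A = nu A.

Definition quantile (nu : set R -> \bar R) (p : R) : R :=
  inf [set x | (p%:E <= nu `]-oo, x]%classic)%E].

(* Mutual independence of the subfamily of X indexed by I. *)
Definition independent_RVs d (T : measurableType d) (P : probability T R)
    (K : choiceType) (I : set K) (X : K -> {RV P >-> R}) : Prop :=
  forall (J : {fset K}) (A : K -> set R),
    [set` J] `<=` I -> (forall i, i \in J -> measurable (A i)) ->
    P (\bigcap_(i in [set` J]) (X i @^-1` A i)) =
    (\prod_(i <- J) P (X i @^-1` A i))%E.

Definition Gamma (s : R) : R :=
  Rintegral lebesgue_measure `]0, +oo[ (fun x => x `^ (s - 1) * expR (- x)).

Definition gamma_pdf (r : R) : R -> R :=
  (fun x => (Gamma r)^-1 * x `^ (r - 1) * expR (- x)) \_ `]0, +oo[.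

(* The value at the single point 0 is immaterial; note that the library's
   powR gives 0 `^ a = 0 for every a != 0, including a < 0. *)
Definition gen_gamma_pdf (r gamma mu : R) : R -> R :=
  (fun x => `|gamma| * mu `^ r / Gamma r * x `^ (gamma * r - 1)
            * expR (- (mu * x `^ gamma))) \_ `[0, +oo[.

(* The law of k G_r / (r G_k), where (G_r, G_k) is realized as the coordinate
   pair under the product of the two gamma laws with shapes r and k. *)
Definition snedecor_fisher (r k : R) : set R -> \bar R :=
  pushforward (density_law (gamma_pdf r) \x density_law (gamma_pdf k))%E
    (fun z : R * R => (k * z.1) / (r * z.2)).

End laws.

Section abnormal_volume_test.
Context {R : realType}.

(* The data are v 1, ..., v m; v 0 and v i for i > m are not used. *)
Definition SR_GG (m : nat) (gamma : R) (v : nat -> R) : R :=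
  (m%:R - 1) * v 1%N `^ gamma / \sum_(2 <= j < m.+1) v j `^ gamma.

(* Homogeneity hypothesis H_0. In applications v 1 is the largest of the
   observed volumes; this concerns the choice of the data to be tested and is
   not a property of the sample V under H_0, which is i.i.d. (V 1 >= V j almost
   surely for all j would contradict this). *)
Definition homogeneity d (T : measurableType d) (P : probability T R)
    (m : nat) (r gamma mu : R) (V : nat -> {RV P >-> R}) : Prop :=
  independent_RVs [set i | (1 <= i <= m)%N] V /\
  forall i, (1 <= i <= m)%N ->
    has_law P (V i) (density_law (gen_gamma_pdf r gamma mu)).

(* The decision rule: H_0 is rejected on the data v, i.e. v 1 is regarded as
   abnormally large. *)
Definition rejects_homogeneity (m : nat) (r gamma alpha : R) (v : nat -> R)
    : Prop :=
  quantile (snedecor_fisher r ((m%:R - 1) * r)) (1 - alpha)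
    < SR_GG m gamma v.

End abnormal_volume_test.

(* Main.v *)
From HB Require Import structures.
Require Import Defs.
From mathcomp Require Import all_boot all_order all_algebra.
From mathcomp Require Import all_classical all_reals all_analysis.
From mathcomp Require Import measurable_realfun.
From mathcomp Require Import ring lra.

Set Implicit Arguments.
Unset Strict Implicit.
Unset Printing Implicit Defensive.

Import Order.TTheory GRing.Theory Num.Theory.
Import numFieldNormedType.Exports.

Local Open Scope classical_set_scope.
Local Open Scope ring_scope.

(** Under the homogeneity hypothesis the variables X_i = mu * V_i^gamma are
    independent, and each of them has the gamma law of shape r, because the
    monotone map x |-> mu * x^gamma transports the generalized gamma density to
    the gamma density (gen_gamma_power_law); the factor mu cancels in the test
    statistic.  Gamma laws are stable under convolution (gamma_law_add), so by
    induction X_2 + ... + X_m has the gamma law of shape k = (m - 1) r and is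
    independent of X_1 (first_rest_sum_law).  As k / r = m - 1, the statistic
    is the ratio k X_1 / (r (X_2 + ... + X_m)), whose law is by definition the
    Snedecor-Fisher law.  This law has no atoms (snedecor_fisher_set1), so its
    distribution function takes the value 1 - alpha at the (1 - alpha)-quantile
    (cdf_quantile), and the statistic exceeds the quantile with probability
    alpha.

    Neither the finiteness of the Gamma integral nor the Euler identity
    B(a, b) = Gamma a * Gamma b / Gamma (a + b) is proved directly.  The gamma
    law of shape r has mass 1 because it is the law of X_1.  If the gamma laws
    of shapes a and b have mass 1, then scaling shows that the density of their
    convolution is proportional to x^(a + b - 1) e^(- x); the convolution has
    mass 1, so the constant of proportionality is the inverse of Gamma (a + b),
    and the latter is finite and positive. *)

(** * Laws given by a density *)

Section density_laws.
Context {R : realType}.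
Local Notation leb := (@lebesgue_measure R).
Local Open Scope ereal_scope.

(** Lebesgue measure on [R] with its canonical Borel structure. The measure
    [lebesgue_measure] is declared on [measurableTypeR R], which has the same
    measurable sets but is indexed by another display; integrals against the
    two measures are not convertible, and products of laws on [R] use the
    canonical structure. *)
Definition lebR : set R -> \bar R := leb.

Let lebR0 : lebR set0 = 0. Proof. exact: measure0. Qed.
Let lebR_ge0 A : 0 <= lebR A. Proof. exact: measure_ge0. Qed.
Let lebR_sigma_additive : semi_sigma_additive lebR.
Proof. exact: (@measure_semi_sigma_additive _ _ _ leb). Qed.

HB.instance Definition _ :=
  isMeasure.Build _ R R lebR lebR0 lebR_ge0 lebR_sigma_additive.

Let lebR_sigma_finite : sigma_finite setT lebR.
Proof. exact: (@sigma_finiteT _ _ _ leb). Qed.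

HB.instance Definition _ :=
  Measure_isSigmaFinite.Build _ R R lebR lebR_sigma_finite.

Lemma ge0_integral_lebR (A : set R) (f : R -> \bar R) :
  measurable A -> measurable_fun A f -> (forall x, 0 <= f x) ->
  \int[leb]_(x in A) f x = \int[lebR]_(x in A) f x.
Proof.
move=> mA mf f0.
have mid : measurable_fun setT (idfun : measurableTypeR R -> R).
  by move=> _ B mB; rewrite setTI preimage_id.
by rewrite -(ge0_integral_pushforward mid leb mA mf).
Qed.

Lemma density_lawE (f : R -> R) (A : set R) : measurable_fun [set: R] f ->
  (forall x, 0 <= f x)%R -> measurable A ->
  density_law f A = \int[lebR]_(x in A) (f x)%:E.
Proof.
move=> mf f0 mA; apply: ge0_integral_lebR => //.
by apply/measurable_funTS/measurable_EFinP.
Qed.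

Lemma density_law_probability (f : R -> R) : measurable_fun [set: R] f ->
  (forall x, 0 <= f x)%R -> density_law f [set: R] = 1 ->
  exists Q : probability R R, Q = density_law f :> (set R -> \bar R).
Proof.
move=> mf f0 f1.
have m0 : density_law f set0 = 0 by rewrite /density_law integral_set0.
have mge0 A : 0 <= density_law f A.
  by apply: integral_ge0 => x _; rewrite lee_fin.
have msa : semi_sigma_additive (density_law f).
  apply: (@semi_sigma_additive_nng_induced _ _ _ leb) => [|x].
    exact/measurable_EFinP.
  by rewrite lee_fin.
pose M1 := isMeasure.Build _ R R (density_law f) m0 mge0 msa.
pose M : {measure set R -> \bar R} := HB.pack (density_law f) M1.
pose M2 := Measure_isProbability.Build _ _ _ M f1.
pose Q : probability R R := HB.pack (density_law f) M1 M2.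
by exists Q.
Qed.

Lemma density_measure d (T : measurableType d)
    (mu : {measure set T -> \bar R}) (f : T -> \bar R) :
  measurable_fun [set: T] f -> (forall x, 0 <= f x) ->
  exists m : {measure set T -> \bar R}, forall A, m A = \int[mu]_(x in A) f x.
Proof.
move=> mf f0; pose m A := \int[mu]_(x in A) f x.
have m0 : m set0 = 0 by rewrite /m integral_set0.
have mge0 A : 0 <= m A by apply: integral_ge0.
have msa : semi_sigma_additive m by exact: semi_sigma_additive_nng_induced.
pose M1 := isMeasure.Build _ _ _ m m0 mge0 msa.
by exists (HB.pack_for {measure set T -> \bar R} m M1).
Qed.

(** The product of two laws with densities [f] and [g] has density
    [f x * g y] with respect to the planar Lebesgue measure. *)
Lemma product_density (f g : R -> R) : measurable_fun [set: R] f ->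
  measurable_fun [set: R] g ->
  (forall x, 0 <= f x)%R -> (forall x, 0 <= g x)%R ->
  density_law f [set: R] = 1 -> density_law g [set: R] = 1 ->
  forall D : set (R * R), measurable D ->
  (density_law f \x density_law g) D =
  \int[lebR]_x \int[lebR]_y ((f x * g y)%:E * (\1_D (x, y))%:E).
Proof.
move=> mf mg f0 g0 f1 g1.
have [Qf QfE] := density_law_probability mf f0 f1.
have [Qg QgE] := density_law_probability mg g0 g1.
have mfg : measurable_fun [set: R * R] (fun z => (f z.1 * g z.2)%:E).
  apply/measurable_EFinP; apply: measurable_funM.
    exact: (measurableT_comp mf).
  exact: (measurableT_comp mg).
have fg0 (z : R * R) : 0 <= (f z.1 * g z.2)%:E by rewrite lee_fin mulr_ge0.
have [m mE] := density_measure (product_measure1 lebR lebR) mfg fg0.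
have mE2 (D : set (R * R)) : measurable D -> m D =
    \int[lebR]_x \int[lebR]_y ((f x * g y)%:E * (\1_D (x, y))%:E).
  move=> mD; rewrite mE integral_mkcond.
  rewrite fubini_tonelli1//=; last 2 first.
  - by apply: (measurable_restrictT _ _).1 => //; exact: measurable_funTS.
  - by move=> z; rewrite erestrict_ge0.
  apply: eq_integral => x _; apply: eq_integral => y _.
  by rewrite epatch_indic.
move=> D mD; rewrite -QfE -QgE -(mE2 _ mD).
apply: (@product_measure_unique _ _ _ _ _ Qf Qg m) => // A B mA mB.
rewrite mE2; last exact: measurableX.
transitivity (density_law f A * density_law g B); last by rewrite -QfE -QgE.
rewrite !density_lawE//.
transitivity (\int[lebR]_x ((f x)%:E * (\1_A x)%:E *
    \int[lebR]_(y in B) (g y)%:E)).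
  apply: eq_integral => x _.
  rewrite [in RHS]integral_mkcond -ge0_integralZl//; last 3 first.
  - apply: (measurable_restrictT _ _).1 => //.
    exact/measurable_funTS/measurable_EFinP.
  - by move=> y _; apply: erestrict_ge0 => z _; rewrite lee_fin.
  - by rewrite mule_ge0 ?lee_fin.
  apply: eq_integral => y _; rewrite epatch_indic.
  have -> : \1_(A `*` B) (x, y) = (\1_A x * \1_B y)%R :> R.
    by rewrite !indicE in_setX /=; case: (x \in A); case: (y \in B);
      rewrite ?(mulr0, mulr1, mul0r).
  by rewrite !EFinM -!muleA; congr (_ * _); rewrite muleCA.
rewrite ge0_integralZr//; last 3 first.
- apply/emeasurable_funM; first exact/measurable_EFinP.
  by apply/measurable_EFinP; exact: measurable_indic.
- by move=> x _; rewrite mule_ge0 ?lee_fin.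
- by apply: integral_ge0 => y _; rewrite lee_fin.
congr (_ * _); rewrite [in RHS]integral_mkcond.
by apply: eq_integral => x _; rewrite epatch_indic.
Qed.

End density_laws.

(** * Affine change of variables and convolution *)

(** The image of a measure by a function that is only known to be measurable by
    a hypothesis, packed as a measure. *)
Definition pushforward_measure d d' (T : measurableType d)
    (T' : measurableType d') (R : realType) (mu : {measure set T -> \bar R})
    (f : T -> T') (mf : measurable_fun setT f) : {measure set T' -> \bar R}.
Proof. refine (pushforward mu f). exact: mf. Defined.

Section affine.
Context {R : realType}.
Local Notation leb := (@lebesgue_measure R).
Local Open Scope ereal_scope.

Lemma lebesgue_measure_affine (c d : R) (A : set R) : (c != 0)%R ->
  measurable A ->
  (`|c|)%:E * leb ((fun x => c * x + d)%R @^-1` A) = leb A.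
Proof.
move=> c0 mA.
pose phi : measurableTypeR R -> measurableTypeR R := fun x => (c * x + d)%R.
have mphi : measurable_fun [set: measurableTypeR R] phi.
  by apply: measurable_funD => //; exact: measurable_funM.
pose ms : {measure set (measurableTypeR R) -> \bar R} :=
  mscale (NngNum (normr_ge0 c)) (pushforward_measure leb mphi).
suff : leb A = ms A by move=> ->.
apply: lebesgue_measure_unique => // _ [[a b]] _ <-.
change (ms _) with ((`|c|)%:E * leb (phi @^-1` [set` (`]a, b])])).
have [ab|ba] := ltP a b; last first.
  by rewrite set_itv_ge -?leNgt// preimage_set0 !measure0 mule0.
rewrite lebesgue_measure_itv/= lte_fin ab.
have [cp|cn|/eqP] := ltgtP c 0%R; last by rewrite (negbTE c0).
- have -> : phi @^-1` `]a, b] = `[((b - d) / c)%R, ((a - d) / c)%R[%classic.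
    apply/seteqP; split => x /=; rewrite !in_itv /= /phi.
      rewrite ler_ndivrMr// ltr_ndivlMr// lerBrDr ltrBlDr mulrC.
      by move=> /andP[-> ->].
    rewrite ler_ndivrMr// ltr_ndivlMr// lerBrDr ltrBlDr mulrC.
    by move=> /andP[-> ->].
  rewrite lebesgue_measure_itv/= lte_fin ltr_nM2r ?invr_lt0// ltrD2r ab.
  rewrite -EFinD -EFinB -EFinM; congr EFin; rewrite ltr0_norm//.
  by field.
- have -> : phi @^-1` `]a, b] = `]((a - d) / c)%R, ((b - d) / c)%R]%classic.
    apply/seteqP; split => x /=; rewrite !in_itv /= /phi.
      rewrite ler_pdivlMr// ltr_pdivrMr// lerBrDr ltrBlDr mulrC.
      by move=> /andP[-> ->].
    rewrite ler_pdivlMr// ltr_pdivrMr// lerBrDr ltrBlDr mulrC.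
    by move=> /andP[-> ->].
  rewrite lebesgue_measure_itv/= lte_fin ltr_pM2r ?invr_gt0// ltrD2r ab.
  rewrite -EFinD -EFinB -EFinM; congr EFin; rewrite gtr0_norm//.
  by field.
Qed.

Lemma ge0_integral_affine (c d : R) (f : R -> \bar R) : (c != 0)%R ->
  measurable_fun [set: R] f -> (forall x, 0 <= f x) ->
  \int[lebR]_x f x = (`|c|)%:E * \int[lebR]_x f (c * x + d)%R.
Proof.
move=> c0 mf f0; pose phi := (fun x : R => c * x + d)%R.
have mphi : measurable_fun [set: R] phi.
  by apply: measurable_funD => //; exact: measurable_funM.
pose push := pushforward_measure lebR mphi.
transitivity ((`|c|)%:E * \int[push]_x f x).
  rewrite -(ge0_integral_mscale push measurableT (NngNum (normr_ge0 c)) mf)//.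
  apply: eq_measure_integral => A mA _; apply/esym.
  exact: lebesgue_measure_affine.
congr (_ * _); rewrite (ge0_integral_pushforward mphi lebR measurableT mf)//.
Qed.
End affine.

Section convolution.
Context {R : realType}.
Local Open Scope ereal_scope.

(** The law of the sum of two independent variables with densities has the
    convolution of the densities as its density. *)
Lemma convolution_density (f g : R -> R) : measurable_fun [set: R] f ->
  measurable_fun [set: R] g ->
  (forall x, 0 <= f x)%R -> (forall x, 0 <= g x)%R ->
  density_law f [set: R] = 1 -> density_law g [set: R] = 1 ->
  forall C : set R, measurable C ->
  (density_law f \x density_law g) [set z | C (z.1 + z.2)%R] =
  \int[lebR]_(s in C) \int[lebR]_x (f x * g (s - x))%:E.
Proof.
move=> mf mg f0 g0 f1 g1 C mC.
have mD : measurable [set z : R * R | C (z.1 + z.2)%R].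
  rewrite -[X in measurable X]setTI.
  have : measurable_fun [set: R * R] (fun z => z.1 + z.2)%R.
    exact: measurable_funD.
  exact.
have mIC : measurable_fun [set: R] (\1_C : R -> R) by exact: measurable_indic.
have mID : measurable_fun [set: R * R]
  (\1_[set z : R * R | C (z.1 + z.2)%R] : _ -> R) by exact: measurable_indic.
rewrite product_density//.
pose F (z : R * R) := (f z.1 * g (z.2 - z.1))%:E * (\1_C z.2)%:E.
have F0 z : 0 <= F z by rewrite mule_ge0 // lee_fin// mulr_ge0.
have mfg : measurable_fun [set: R * R] (fun z => f z.1 * g (z.2 - z.1))%R.
  apply: measurable_funM; first exact: (measurableT_comp mf).
  by apply: (measurableT_comp mg); exact: measurable_funB.
have mF : measurable_fun setT F.
  apply: emeasurable_funM; first exact/measurable_EFinP.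
  by apply/measurable_EFinP; exact: (measurableT_comp mIC).
transitivity (\int[lebR]_x \int[lebR]_s F (x, s)).
  apply: eq_integral => x _.
  rewrite (@ge0_integral_affine _ 1 (- x))//; last 2 first.
  - apply: emeasurable_funM; apply/measurable_EFinP.
      exact: measurable_funM.
    exact: (measurableT_comp mID).
  - by move=> y; rewrite mule_ge0 // lee_fin// mulr_ge0.
  rewrite normr1 mul1e; apply: eq_integral => s _.
  rewrite mul1r /F /=; congr (_ * _).
  have -> // : \1_[set z : R * R | C (z.1 + z.2)%R] (x, s - x)%R = \1_C s :> R.
  rewrite !indicE; congr (_ %:R); congr nat_of_bool.
  by apply/idP/idP; rewrite !inE /= addrC subrK.
rewrite fubini_tonelli//.
rewrite [RHS]integral_mkcond; apply: eq_integral => s _.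
rewrite epatch_indic -ge0_integralZr//; first last.
- by rewrite lee_fin.
- by move=> x _; rewrite lee_fin mulr_ge0.
- apply/measurable_EFinP; apply: measurable_funM => //.
  by apply: (measurableT_comp mg); exact: measurable_funB.
Qed.

Lemma mule_eq1_ge0 (x y : \bar R) : 0 <= x -> 0 <= y -> x * y = 1 ->
  exists r : R, [/\ (0 < r)%R, y = r%:E & x = r^-1%:E].
Proof.
case: x => [x| |]//; case: y => [y| |]//; rewrite ?lee_fin => x0 y0.
- rewrite -EFinM => -[xy1]; exists y.
  have yN0 : y != 0%R by apply/eqP => y00; move: xy1; rewrite y00 mulr0; lra.
  split => //; first by rewrite lt_neqAle eq_sym yN0.
  by rewrite -(mulfK yN0 x) xy1 mul1r.
- have [->|xN0] := eqVneq x 0%R; first by rewrite mul0e => -[]; lra.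
  by rewrite gt0_muley// lte_fin lt_neqAle eq_sym xN0.
- have [->|yN0] := eqVneq y 0%R; first by rewrite mule0 => -[]; lra.
  by rewrite gt0_mulye// lte_fin lt_neqAle eq_sym yN0.
Qed.

End convolution.

(** * Gamma laws *)

Section gamma.
Context {R : realType}.
Local Open Scope ereal_scope.
Implicit Types (s r x : R).

(** The gamma density without its normalizing constant. *)
Definition gamma_kernel s : R -> R :=
  (fun x => x `^ (s - 1) * expR (- x))%R \_ `]0%R, +oo[.

Lemma gamma_kernelE s x : gamma_kernel s x =
  if (0 < x)%R then (x `^ (s - 1) * expR (- x))%R else 0%R.
Proof. by rewrite /gamma_kernel patchE mem_setE in_itv/= andbT. Qed.

Lemma gamma_kernel_ge0 s x : (0 <= gamma_kernel s x)%R.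
Proof.
rewrite gamma_kernelE; case: ifP => // _.
by rewrite mulr_ge0 ?powR_ge0 ?expR_ge0.
Qed.

Lemma measurable_gamma_kernel s : measurable_fun [set: R] (gamma_kernel s).
Proof.
apply: (measurable_restrictT _ _).1 => //; apply: measurable_funTS.
apply: measurable_funM; first exact: measurable_powR.
exact: measurableT_comp.
Qed.

Lemma gamma_pdfE s x : gamma_pdf s x = ((Gamma s)^-1 * gamma_kernel s x)%R.
Proof.
rewrite /gamma_pdf /gamma_kernel !patchE; case: ifP => _; last by rewrite mulr0.
by rewrite mulrA.
Qed.

(** The integrand of the Beta integral, with the two constants contributed by
    the gamma densities of shapes [a] and [b]. *)
Definition beta_kernel a b : R -> R := fun t =>
  ((Gamma a)^-1 * (Gamma b)^-1 *
   ((fun t => t `^ (a - 1) * (1 - t) `^ (b - 1)) \_ `]0%R, 1%R[) t)%R.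

Lemma GammaE s : Gamma s = fine (\int[lebR]_x (gamma_kernel s x)%:E).
Proof.
rewrite /Gamma /Rintegral; congr fine.
rewrite integral_mkcond; set h := _ \_ _.
have -> : h = EFin \o gamma_kernel s by rewrite /h /gamma_kernel -restrict_EFin.
have mk : measurable_fun [set: R] (EFin \o gamma_kernel s).
  by apply/measurable_EFinP; exact: measurable_gamma_kernel.
by rewrite ge0_integral_lebR// => x; rewrite /= lee_fin gamma_kernel_ge0.
Qed.

Lemma Gamma_ge0 s : (0 <= Gamma s)%R.
Proof.
rewrite GammaE fine_ge0//; apply: integral_ge0 => x _.
by rewrite lee_fin gamma_kernel_ge0.
Qed.

Lemma gamma_pdf_ge0 s x : (0 <= gamma_pdf s x)%R.
Proof.
by rewrite gamma_pdfE mulr_ge0 ?gamma_kernel_ge0// invr_ge0 Gamma_ge0.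
Qed.

Lemma measurable_gamma_pdf s : measurable_fun [set: R] (gamma_pdf s).
Proof.
rewrite (_ : gamma_pdf s = fun x => (Gamma s)^-1 * gamma_kernel s x)%R;
  last first.
  by apply/funext => x; exact: gamma_pdfE.
by apply: measurable_funM => //; exact: measurable_gamma_kernel.
Qed.

Lemma beta_kernel_ge0 a b t : (0 <= beta_kernel a b t)%R.
Proof.
rewrite mulr_ge0// ?mulr_ge0 ?invr_ge0 ?Gamma_ge0//.
by rewrite patchE; case: ifP => // _; rewrite mulr_ge0 ?powR_ge0.
Qed.

(** The substitution [x = s * t] separates the variables in the convolution of
    two gamma densities at [s]. *)
Lemma convolution_gamma_kernel (a b s : R) :
  \int[lebR]_x (gamma_pdf a x * gamma_pdf b (s - x))%:E =
  (\int[lebR]_t (beta_kernel a b t)%:E) *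
  (gamma_kernel (a + b) s)%:E.
Proof.
have mg : measurable_fun [set: R]
    (fun x => gamma_pdf a x * gamma_pdf b (s - x))%R.
  apply: measurable_funM; first exact: measurable_gamma_pdf.
  apply: (measurableT_comp (@measurable_gamma_pdf b)).
  exact: measurable_funB.
rewrite (gamma_kernelE _ s); case: ifPn => [s0|]; last first.
  rewrite -leNgt => s0; rewrite mule0 integral0_eq// => x _.
  rewrite !gamma_pdfE !gamma_kernelE.
  case: ifPn => x0; last by rewrite mulr0 mul0r.
  by rewrite subr_gt0 ltNge (le_trans s0 (ltW x0))/= !mulr0.
rewrite (@ge0_integral_affine _ s 0)//; last 3 first.
- by rewrite gt_eqF.
- exact/measurable_EFinP.
- by move=> x; rewrite lee_fin mulr_ge0 ?gamma_pdf_ge0.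
rewrite -ge0_integralZl//; last 2 first.
- apply/measurable_EFinP; apply: (measurableT_comp mg).
  by apply: measurable_funD => //; exact: measurable_funM.
- by move=> x _; rewrite lee_fin mulr_ge0 ?gamma_pdf_ge0.
rewrite -ge0_integralZr//; last 3 first.
- apply/measurable_EFinP; apply: measurable_funM => //.
  apply: (measurable_restrictT _ _).1 => //; apply: measurable_funTS.
  apply: measurable_funM; first exact: measurable_powR.
  have mp : measurable_fun [set: R] (fun x => x `^ (b - 1))%R.
    exact: measurable_powR.
  by apply: (measurableT_comp mp); exact: measurable_funB.
- by move=> t _; rewrite lee_fin beta_kernel_ge0.
- by rewrite lee_fin mulr_ge0 ?powR_ge0 ?expR_ge0.
apply: eq_integral => t _; rewrite -!EFinM addr0; congr EFin.
rewrite /beta_kernel gtr0_norm// !gamma_pdfE !gamma_kernelE.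
rewrite patchE mem_setE in_itv/=.
rewrite pmulr_rgt0// -[X in (0 < X - s * t)%R]mulr1 -mulrBr.
rewrite pmulr_rgt0// subr_gt0.
have [t0|] := ltP 0%R t; last by rewrite !(mulr0, mul0r).
have [t1|] := ltP t 1%R; last by rewrite !(mulr0, mul0r).
rewrite -[X in (X - s * t)%R]mulr1 -mulrBr.
rewrite !powRM ?subr_ge0 ?(ltW s0) ?(ltW t0) ?(ltW t1)//.
have -> : (- (s * (1 - t)) = - s + s * t)%R by ring.
rewrite expRD.
have -> : (expR (- (s * t)) = (expR (s * t))^-1)%R by rewrite expRN.
have -> : (s `^ (a + b - 1) = s `^ (a - 1) * s `^ (b - 1) * s)%R.
  rewrite -[X in (_ * X)%R](powRr1 (ltW s0)) -!powRD ?(gt_eqF s0) ?implybT//.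
  by congr (_ `^ _)%R; ring.
have eN0 : expR (s * t) != 0%R by rewrite gt_eqF ?expR_gt0.
rewrite expRN /=.
have e2N0 : expR s != 0%R by rewrite gt_eqF ?expR_gt0.
move: (Gamma a)^-1%R (Gamma b)^-1%R => ga gb.
by field; rewrite eN0 e2N0.
Qed.

(** Additivity of the shape parameter. That the law of shape [a + b] has mass 1
    is part of the conclusion: it is read off from the total mass of the
    convolution. *)
Lemma gamma_law_add (a b : R) :
  density_law (gamma_pdf a) [set: R] = 1 ->
  density_law (gamma_pdf b) [set: R] = 1 ->
  density_law (gamma_pdf (a + b)) [set: R] = 1 /\
  forall C : set R, measurable C ->
  (density_law (gamma_pdf a) \x density_law (gamma_pdf b))
    [set z | C (z.1 + z.2)%R] =
  density_law (gamma_pdf (a + b)) C.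
Proof.
move=> a1 b1.
have := convolution_density (@measurable_gamma_pdf a) (@measurable_gamma_pdf b)
  (@gamma_pdf_ge0 a) (@gamma_pdf_ge0 b) a1 b1.
set prod := _ \x _ => convE.
pose K := (\int[lebR]_t (beta_kernel a b t)%:E).
have K0 : 0 <= K.
  by apply: integral_ge0 => t _; rewrite lee_fin beta_kernel_ge0.
have mk C : measurable_fun C (fun x => (gamma_kernel (a + b) x)%:E).
  by apply/measurable_EFinP/measurable_funTS; exact: measurable_gamma_kernel.
have k0 x : 0 <= (gamma_kernel (a + b) x)%:E.
  by rewrite lee_fin gamma_kernel_ge0.
have convKE (C : set R) : measurable C ->
    prod [set z : R * R | C (z.1 + z.2)%R] =
    K * \int[lebR]_(s in C) (gamma_kernel (a + b) s)%:E.
  move=> mC; rewrite convE// -ge0_integralZl//.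
  by apply: eq_integral => s _; rewrite convolution_gamma_kernel.
have [Qa QaE] := density_law_probability (@measurable_gamma_pdf a)
  (@gamma_pdf_ge0 a) a1.
have [Qb QbE] := density_law_probability (@measurable_gamma_pdf b)
  (@gamma_pdf_ge0 b) b1.
have prodT : prod setT = 1.
  transitivity (Qa setT * Qb setT); last by rewrite !probability_setT mule1.
  by rewrite /prod -QaE -QbE -setXTT; exact: product_measure1E.
have I0 : 0 <= \int[lebR]_s (gamma_kernel (a + b) s)%:E by exact: integral_ge0.
(* The total mass 1 of the convolution determines both factors. *)
have [r [r0 IE KE]] : exists r : R, [/\ (0 < r)%R,
    \int[lebR]_s (gamma_kernel (a + b) s)%:E = r%:E & K = r^-1%:E].
  by apply: mule_eq1_ge0 => //; rewrite -convKE.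
have GE : Gamma (a + b) = r by rewrite GammaE IE.
have lawE (C : set R) : measurable C -> density_law (gamma_pdf (a + b)) C =
    K * \int[lebR]_(s in C) (gamma_kernel (a + b) s)%:E.
  move=> mC; rewrite density_lawE//;
    [|exact: measurable_gamma_pdf|exact: gamma_pdf_ge0].
  rewrite -ge0_integralZl//; apply: eq_integral => s _.
  by rewrite gamma_pdfE GE KE EFinM.
split; last by move=> C mC; rewrite convKE// lawE.
by rewrite lawE// -convKE.
Qed.

End gamma.

(** * Powers of generalized gamma variables *)

Section measure_unique_pos.
Context {R : realType}.
Local Open Scope ereal_scope.

Lemma measure_itvoy_cvg (m : {measure set R -> \bar R}) (x : R) :
  m `[(x + n.+1%:R^-1)%R, (x + n.+1%:R)%R]%classic @[n --> \oo] -->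
  m `]x, +oo[%classic.
Proof.
have -> : `]x, +oo[%classic =
    \bigcup_n `[(x + n.+1%:R^-1)%R, (x + n.+1%:R)%R]%classic.
  apply/seteqP; split => y /=; rewrite in_itv/= ?andbT.
    move=> xy; pose n := maxn (Num.truncn (y - x)) (Num.truncn (y - x)^-1).
    have yx0 : (0 < y - x)%R by rewrite subr_gt0.
    exists n => //; rewrite /= in_itv/= -lerBrDl -[X in _ && X]lerBlDl.
    apply/andP; split.
      rewrite -[leRHS]invrK lef_pV2 ?posrE ?invr_gt0//.
      rewrite (le_trans (ltW (truncnS_gt _)))// ler_nat ltnS /n.
      exact: leq_maxr.
    rewrite (le_trans (ltW (truncnS_gt _)))// ler_nat ltnS /n.
    exact: leq_maxl.
  move=> [n _]; rewrite /= in_itv/= => /andP[+ _]; apply: lt_le_trans.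
  by rewrite ltrDl invr_gt0.
apply: (nondecreasing_cvg_mu (mu := m)) => //.
  by apply: bigcup_measurable => n _; exact: measurable_itv.
move=> n k nk; apply/subsetPset => y /=; rewrite !in_itv/= => /andP[h1 h2].
apply/andP; split.
  by apply: le_trans h1; rewrite lerD2l lef_pV2 ?posrE// ler_nat.
by apply: (le_trans h2); rewrite lerD2l ler_nat.
Qed.

(** A finite measure carried by the positive half-line is determined by its
    values on the compact intervals of positive numbers. *)
Lemma measure_unique_pos (m1 m2 : {measure set R -> \bar R}) :
  m1 setT < +oo -> m1 `]-oo, 0%R]%classic = 0 -> m2 `]-oo, 0%R]%classic = 0 ->
  (forall c d : R, (0 < c)%R -> (c <= d)%R ->
     m1 `[c, d]%classic = m2 `[c, d]%classic) ->
  forall A, measurable A -> m1 A = m2 A.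
Proof.
move=> m1T m10 m20 m12.
have pos x : (0 <= x)%R -> m1 `]x, +oo[%classic = m2 `]x, +oo[%classic.
  move=> x0; apply: (cvg_unique _ (@measure_itvoy_cvg m1 x)) => //.
  rewrite (_ : (fun n => _) =
    (fun n => m2 `[(x + n.+1%:R^-1)%R, (x + n.+1%:R)%R]%classic)).
    exact: measure_itvoy_cvg.
  apply/funext => n; apply: m12; first by rewrite ltr_wpDl// invr_gt0.
  rewrite lerD2l (@le_trans _ _ 1%R)// ?invf_le1// ler1n//.
have neg (m : {measure set R -> \bar R}) x : (x < 0)%R ->
    m `]-oo, 0%R]%classic = 0 -> m `]x, +oo[%classic = m `]0%R, +oo[%classic.
  move=> x0 m0.
  have -> : `]x, +oo[%classic = `]x, 0%R]%classic `|` `]0%R, +oo[%classic.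
    by rewrite -itv_bndbnd_setU// bnd_simp ltW.
  rewrite measureU//; last first.
    apply/seteqP; split => // y [] /=; rewrite !in_itv/= andbT => /andP[_ y0].
    by rewrite ltNge y0.
  rewrite (@subset_measure0 _ _ _ _ `]x, 0%R]%classic `]-oo, 0%R]%classic)//
    ?add0e//.
  by move=> y /=; rewrite !in_itv/= => /andP[].
apply: (@measure_unique _ R R [set A | exists x, A = `]x, +oo[%classic]
   (fun n => `](- n%:R)%R, +oo[%classic) _ _ _ _ m1 m2).
- exact: RGenOInfty.measurableE.
- move=> _ _ [x ->] [y ->]; exists (Num.max x y).
  by apply/seteqP; split => z /=; rewrite !in_itv/= !andbT gt_max => /andP.
- by move=> n; eexists.
- apply/seteqP; split => // x _; exists (Num.truncn `|x|).+1 => //=.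
  rewrite in_itv/= andbT ltrNl; apply: le_lt_trans (truncnS_gt _).
  by rewrite -normrN ler_norm.
- move=> _ [x ->]; have [x0|x0] := leP 0%R x; first exact: pos.
  by rewrite !neg// pos.
- move=> k; apply: le_lt_trans m1T; apply: le_measure => //; rewrite inE//.
Qed.
End measure_unique_pos.

Section powR_calculus.
Context {R : realType}.
Implicit Types x p : R.

Lemma continuous_powR p x : 0 < x -> {for x, continuous (fun y => y `^ p)}.
Proof.
move=> x0; apply: differentiable_continuous; rewrite -derivable1_diffP.
by apply: derivable_powR; rewrite in_itv/= andbT.
Qed.

Lemma is_derive_scaled_powR (mu p x : R) : 0 < x ->
  is_derive x 1 (fun y => mu * y `^ p) (mu * (p * x `^ (p - 1))).
Proof. by move=> x0; have := is_derive1_powR p x0 => ?; apply: is_deriveZ. Qed.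

Lemma cvg_derive_scaled_powR (mu p x : R) : 0 < x ->
  (fun y => mu * y `^ p)^`()%classic y @[y --> x] --> mu * (p * x `^ (p - 1)).
Proof.
move=> x0.
have h : mu * (p * y `^ (p - 1)) @[y --> x] --> mu * (p * x `^ (p - 1)).
  by apply: cvgMr; apply: cvgMr; exact: continuous_powR.
apply: cvg_trans h; apply: near_eq_cvg.
near=> y; rewrite derive1E.
have y0 : 0 < y by near: y; exact: lt_nbhsr.
by have := is_derive_scaled_powR mu p y0 => ?; rewrite derive_val.
Unshelve. all: end_near. Qed.

End powR_calculus.

Section generalized_gamma.
Context {R : realType}.
Local Notation leb := (@lebesgue_measure R).
Variables (r g mu : R).
Hypotheses (g0 : g != 0) (mu0 : 0 < mu).

Let phi := fun x : R => mu * x `^ g.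

Lemma gen_gamma_pdf_ge0 (x : R) : 0 <= gen_gamma_pdf r g mu x.
Proof.
rewrite /gen_gamma_pdf patchE; case: ifP => // _.
by rewrite !mulr_ge0 ?powR_ge0 ?expR_ge0 ?invr_ge0 ?Gamma_ge0.
Qed.

Lemma measurable_gen_gamma_pdf : measurable_fun [set: R] (gen_gamma_pdf r g mu).
Proof.
apply: (measurable_restrictT _ _).1 => //; apply: measurable_funTS.
apply: measurable_funM.
  by apply: measurable_funM => //; exact: measurable_powR.
apply: measurableT_comp => //; apply: measurableT_comp => //.
by apply: measurable_funM => //; exact: measurable_powR.
Qed.

Lemma gen_gamma_pdf_pos (x : R) : 0 < x -> gen_gamma_pdf r g mu x =
  gamma_pdf r (phi x) * (mu * (`|g| * x `^ (g - 1))).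
Proof.
move=> x0; rewrite gamma_pdfE gamma_kernelE mulr_gt0 ?powR_gt0//.
rewrite /gen_gamma_pdf patchE mem_setE in_itv/= andbT (ltW x0).
rewrite powRM ?powR_ge0 ?(ltW mu0)// -powRrM.
have -> : mu `^ r = mu * mu `^ (r - 1).
  by rewrite -{2}(powRr1 (ltW mu0)) -powRD ?(gt_eqF mu0) ?implybT// addrC subrK.
have -> : x `^ (g * r - 1) = x `^ (g * (r - 1)) * x `^ (g - 1).
  by rewrite -powRD ?(gt_eqF x0) ?implybT//; congr (_ `^ _); ring.
move: (Gamma r)^-1 => G; rewrite /phi; ring.
Qed.

Let phi_pos x : 0 < x -> 0 < phi x.
Proof. by move=> x0; rewrite mulr_gt0// powR_gt0. Qed.

Let phi_inj (x y : R) : 0 < x -> 0 < y -> 0 < g -> (phi x <= phi y) = (x <= y).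
Proof.
move=> x0 y0 gp; rewrite /phi ler_pM2l//; apply/idP/idP; last first.
  move=> xy; apply: ge0_ler_powR => //.
  - exact: ltW.
  - by rewrite nnegrE ltW.
  - by rewrite nnegrE ltW.
apply: contraTT; rewrite -!ltNge => yx.
by apply: gt0_ltr_powR; rewrite ?nnegrE ?(ltW x0) ?(ltW y0).
Qed.

Let phi_injN (x y : R) : 0 < x -> 0 < y -> g < 0 -> (phi x <= phi y) = (y <= x).
Proof.
move=> x0 y0 gn; rewrite /phi ler_pM2l//.
rewrite -(opprK g) !(powRN _ (- g)) lef_pV2 ?posrE ?powR_gt0//.
apply/idP/idP; last first.
  move=> xy; apply: ge0_ler_powR => //.
  - by rewrite oppr_ge0 ltW.
  - by rewrite nnegrE ltW.
  - by rewrite nnegrE ltW.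
apply: contraTT; rewrite -!ltNge => yx.
by apply: gt0_ltr_powR; rewrite ?nnegrE ?oppr_gt0 ?(ltW x0) ?(ltW y0).
Qed.

Let G (x : R) : R := (Gamma r)^-1 * (x `^ (r - 1) * expR (- x)).

Let GE x : 0 < x -> gamma_pdf r x = G x.
Proof. by move=> x0; rewrite gamma_pdfE gamma_kernelE x0. Qed.

Let G_cont (a b : R) : 0 < a -> {within `[a, b], continuous G}.
Proof.
move=> a0; apply: continuous_in_subspaceT => x.
rewrite inE/= in_itv/= => /andP[ax _].
have x0 := lt_le_trans a0 ax.
apply: cvgMr; apply: cvgM; first exact: continuous_powR.
apply: (@continuous_comp _ _ _ -%R (@expR R)); last exact: continuous_expR.
exact: opp_continuous.
Qed.

Let phi_derivable (a b : R) :
  0 < a -> 0 < b -> derivable_oo_LRcontinuous phi a b.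
Proof.
move=> a0 b0; split.
- move=> x; rewrite in_itv/= => /andP[ax _].
  by have [] := is_derive_scaled_powR mu g (lt_trans a0 ax).
- by apply: cvg_at_right_filter; apply: cvgMr; exact: continuous_powR.
- by apply: cvg_at_left_filter; apply: cvgMr; exact: continuous_powR.
Qed.

Let phi_deriv x : 0 < x -> phi^`()%classic x = mu * (g * x `^ (g - 1)).
Proof.
move=> x0; rewrite derive1E.
by have := is_derive_scaled_powR mu g x0 => ?; rewrite derive_val.
Qed.

Let phi_cont (a b : R) : 0 < a -> {in `]a, b[, continuous phi^`()%classic}.
Proof.
move=> a0 x; rewrite in_itv/= => /andP[ax _].
have x0 := lt_trans a0 ax.
by rewrite /continuous_at phi_deriv//; exact: cvg_derive_scaled_powR.
Qed.

Local Open Scope ereal_scope.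

(** [Num.min] and [Num.max] cover both signs of [g]: the map [phi] is increasing
    for [0 < g] and decreasing for [g < 0]. *)
Lemma gen_gamma_substitution (a b : R) : (0 < a)%R -> (a <= b)%R ->
  density_law (gen_gamma_pdf r g mu) `[a, b]%classic =
  density_law (gamma_pdf r)
    `[Num.min (phi a) (phi b), Num.max (phi a) (phi b)]%classic.
Proof.
move=> a0 ab; have b0 := lt_le_trans a0 ab.
rewrite /density_law.
have gl : cvg (phi^`()%classic x @[x --> a^'+]).
  apply/cvg_ex; exists (mu * (g * a `^ (g - 1)))%R.
  by apply: cvg_at_right_filter; exact: cvg_derive_scaled_powR.
have gr : cvg (phi^`()%classic x @[x --> b^'-]).
  apply/cvg_ex; exists (mu * (g * b `^ (g - 1)))%R.
  by apply: cvg_at_left_filter; exact: cvg_derive_scaled_powR.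
have [gn|gp] : (g < 0)%R \/ (0 < g)%R by apply/orP; rewrite -neq_lt.
- have pab : (phi b <= phi a)%R by rewrite phi_injN.
  rewrite (min_idPr pab) (max_idPl pab).
  transitivity (\int[leb]_(x in `[phi b, phi a]) (G x)%:E); last first.
    apply: eq_integral => x; rewrite inE/= in_itv/= => /andP[h _].
    by rewrite GE// (lt_le_trans _ h)// phi_pos.
  have decr : {in `[a, b] &, {homo phi : x y /~ (x < y)%R}}.
    move=> x y; rewrite !in_itv/= => /andP[ax _] /andP[ay _].
    by rewrite !ltNge phi_injN// (lt_le_trans a0).
  rewrite (integration_by_substitution_decreasing ab decr
    (@phi_cont a b a0) gl gr (phi_derivable a0 b0)
    (@G_cont _ (phi a) (phi_pos b0))).
  apply: eq_integral => x; rewrite inE/= in_itv/= => /andP[h _].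
  have x0 := lt_le_trans a0 h.
  rewrite gen_gamma_pdf_pos// GE ?phi_pos//= /=; congr EFin.
  transitivity (G (phi x) * - (phi^`()%classic x))%R => //.
  by rewrite phi_deriv// ltr0_norm// mulNr mulrN.
- have pab : (phi a <= phi b)%R by rewrite phi_inj.
  rewrite (min_idPl pab) (max_idPr pab).
  transitivity (\int[leb]_(x in `[phi a, phi b]) (G x)%:E); last first.
    apply: eq_integral => x; rewrite inE/= in_itv/= => /andP[h _].
    by rewrite GE// (lt_le_trans _ h)// phi_pos.
  have incr : {in `[a, b] &, {homo phi : x y / (x < y)%R}}.
    move=> x y; rewrite !in_itv/= => /andP[ax _] /andP[ay _].
    by rewrite !ltNge phi_inj// (lt_le_trans a0).
  rewrite (integration_by_substitution_increasing ab incr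
    (@phi_cont a b a0) gl gr (phi_derivable a0 b0)
    (@G_cont _ (phi b) (phi_pos a0))).
  apply: eq_integral => x; rewrite inE/= in_itv/= => /andP[h _].
  have x0 := lt_le_trans a0 h.
  rewrite gen_gamma_pdf_pos// GE ?phi_pos//= /=; congr EFin.
  transitivity (G (phi x) * phi^`()%classic x)%R => //.
  by rewrite phi_deriv// gtr0_norm.
Qed.

(* The density vanishes on the negative numbers, and its value at 0 does not
   matter. *)
Let gen_gamma_law_pos (A : set R) : measurable A ->
  density_law (gen_gamma_pdf r g mu) A =
  density_law (gen_gamma_pdf r g mu) (A `&` `]0%R, +oo[%classic).
Proof.
move=> mA; rewrite /density_law.
have mA0 : measurable (A `\ 0%R) by exact: measurableD.
have mf : measurable_fun (A `\ 0%R) (fun x => (gen_gamma_pdf r g mu x)%:E).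
  by apply/measurable_EFinP/measurable_funTS; exact: measurable_gen_gamma_pdf.
rewrite -(integral_setD1 mA0 mf) integral_mkcond [RHS]integral_mkcond.
apply: eq_integral => x _; rewrite !patchE.
have [x0|x0|->] := ltgtP x 0%R.
- rewrite [in RHS]memNset//; last first.
    by move=> [_]; rewrite /= in_itv/= ltNge (ltW x0).
  case: ifP => // _; rewrite /gen_gamma_pdf patchE mem_setE in_itv/=.
  by rewrite leNgt x0.
- congr (if _ then _ else _); apply/idP/idP; rewrite !inE/=.
    by move=> [Ax _]; split=> //; rewrite in_itv/= x0.
  by move=> [Ax _]; split=> // xE; rewrite xE ltxx in x0.
- rewrite !memNset//; first by move=> [_]; rewrite /= in_itv/= ltxx.
  by move=> [_ /=]; exact.
Qed.

(** If a variable [W] has the generalized gamma law, then [mu * W `^ g] has the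
    gamma law of shape [r]. *)
Lemma gen_gamma_power_law (B : set R) : measurable B ->
  density_law (gen_gamma_pdf r g mu) [set: R] = 1 ->
  density_law (gen_gamma_pdf r g mu) ((fun x => mu * x `^ g)%R @^-1` B) =
  density_law (gamma_pdf r) B.
Proof.
move=> mB gen1.
have [Q QE] := density_law_probability measurable_gen_gamma_pdf
  gen_gamma_pdf_ge0 gen1.
have mphi : measurable_fun [set: R] phi.
  by apply: measurable_funM => //; exact: measurable_powR.
have mgam : measurable_fun [set: R] (fun x => (gamma_pdf r x)%:E).
  by apply/measurable_EFinP; exact: measurable_gamma_pdf.
have gam0 x : 0 <= (gamma_pdf r x)%:E by rewrite lee_fin gamma_pdf_ge0.
have [m mE] := density_measure lebR mgam gam0.
have mgE A : measurable A -> m A = density_law (gamma_pdf r) A.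
  by move=> mA; rewrite mE density_lawE//; exact: measurable_gamma_pdf.
pose push := pushforward_measure Q mphi.
have pushE A : push A = density_law (gen_gamma_pdf r g mu) (phi @^-1` A).
  by rewrite -QE.
rewrite -pushE -mgE//; move: B mB; apply: measure_unique_pos.
- by rewrite pushE preimage_setT gen1 ltry.
- rewrite pushE; apply: (@integral_Sset1 _ _ _ 0%R) => x /=; rewrite in_itv/=.
  rewrite pmulr_rle0// => xg; apply: (@powR_eq0_eq0 _ _ g).
  by apply/eqP; rewrite eq_le xg powR_ge0.
- rewrite mgE//; apply: integral0_eq => x; rewrite /= in_itv/= => x0.
  by rewrite gamma_pdfE gamma_kernelE ltNge x0 mulr0.
move=> c d c0 cd; have d0 := lt_le_trans c0 cd.
(* The inverse of phi on the positive half-line. *)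
pose psi y := ((y / mu) `^ g^-1)%R.
have psi_pos y : (0 < y)%R -> (0 < psi y)%R.
  by move=> y0; rewrite powR_gt0// divr_gt0.
have psiK y : (0 < y)%R -> phi (psi y) = y.
  move=> y0; rewrite /phi /psi -powRrM mulVf//.
  rewrite powRr1 ?divr_ge0 ?(ltW y0) ?(ltW mu0)//.
  by rewrite mulrC divfK// gt_eqF.
rewrite mgE// pushE gen_gamma_law_pos; last first.
  rewrite -[X in measurable X]setTI.
  exact: (mphi measurableT _ (measurable_itv _)).
have [gn|gp] : (g < 0)%R \/ (0 < g)%R by apply/orP; rewrite -neq_lt.
- have -> : phi @^-1` `[c, d]%classic `&` `]0%R, +oo[%classic =
      `[psi d, psi c]%classic.
    apply/seteqP; split => x; rewrite /= !in_itv/= ?andbT.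
      move=> [/andP[cx xd] x0]; apply/andP; split.
        by rewrite -(phi_injN x0 (psi_pos _ d0) gn) (psiK _ d0).
      by rewrite -(phi_injN (psi_pos _ c0) x0 gn) (psiK _ c0).
    move=> /andP[dx xc]; have x0 := lt_le_trans (psi_pos _ d0) dx.
    split=> //; apply/andP; split.
      by rewrite -{1}(psiK _ c0) (phi_injN (psi_pos _ c0) x0 gn).
    by rewrite -[leRHS](psiK _ d0) (phi_injN x0 (psi_pos _ d0) gn).
  have dc : (psi d <= psi c)%R.
    rewrite -(phi_injN (psi_pos _ c0) (psi_pos _ d0) gn).
    by rewrite (psiK _ c0) (psiK _ d0).
  rewrite (gen_gamma_substitution (psi_pos _ d0) dc) (psiK _ c0) (psiK _ d0).
  by rewrite (min_idPr cd) (max_idPl cd).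
- have -> : phi @^-1` `[c, d]%classic `&` `]0%R, +oo[%classic =
      `[psi c, psi d]%classic.
    apply/seteqP; split => x; rewrite /= !in_itv/= ?andbT.
      move=> [/andP[cx xd] x0]; apply/andP; split.
        by rewrite -(phi_inj (psi_pos _ c0) x0 gp) (psiK _ c0).
      by rewrite -(phi_inj x0 (psi_pos _ d0) gp) (psiK _ d0).
    move=> /andP[cx xd]; have x0 := lt_le_trans (psi_pos _ c0) cx.
    split=> //; apply/andP; split.
      by rewrite -{1}(psiK _ c0) (phi_inj (psi_pos _ c0) x0 gp).
    by rewrite -[leRHS](psiK _ d0) (phi_inj x0 (psi_pos _ d0) gp).
  have cdpsi : (psi c <= psi d)%R.
    rewrite -(phi_inj (psi_pos _ c0) (psi_pos _ d0) gp).
    by rewrite (psiK _ c0) (psiK _ d0).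
  rewrite (gen_gamma_substitution (psi_pos _ c0) cdpsi) (psiK _ c0) (psiK _ d0).
  by rewrite (min_idPl cd) (max_idPr cd).
Qed.

End generalized_gamma.

(** * Sums of independent gamma variables *)

Section joint_law.
Context d (T : measurableType d) (R : realType) (P : probability T R).
Local Open Scope ereal_scope.

(** If [E], [X] and [Y] are independent and [X], [Y] have laws [mu], [nu], then
    the pair [(X, Y)] is independent of [E] and has law [mu \x nu]. *)
Lemma joint_law_product (E : set T) (X Y : T -> R) (mu nu : probability R R) :
  measurable E -> measurable_fun setT X -> measurable_fun setT Y ->
  (forall A B, measurable A -> measurable B ->
     P (E `&` (X @^-1` A `&` Y @^-1` B)) = P E * (mu A * nu B)) ->
  forall D : set (R * R), measurable D ->
    P (E `&` (fun w => (X w, Y w)) @^-1` D) = P E * (mu \x nu) D.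
Proof.
move=> mE mX mY EXY D mD.
have mXY : measurable_fun setT (fun w => (X w, Y w)).
  exact: measurable_fun_pair.
have mXYD : measurable ((fun w => (X w, Y w)) @^-1` D).
  by rewrite -[X in measurable X]setTI; exact: mXY.
(* For an event of positive probability, product measures are compared with the
   conditional law of (X, Y) given E. *)
have [PE0|PE0] := eqVneq (P E) 0.
  rewrite PE0 mul0e; apply: (@subset_measure0 _ _ _ _ _ E) => //.
  exact: measurableI.
have PEfin : P E \is a fin_num by exact: fin_num_measure.
have pE0 : (0 < fine (P E))%R.
  by rewrite fine_gt0// lt0e PE0 measure_ge0/= ltey_eq PEfin.
have pV0 : (0 <= (fine (P E))^-1)%R by rewrite invr_ge0 ltW.
pose m : {measure set (R * R) -> \bar R} :=
  mscale (NngNum pV0) (pushforward_measure (mrestr P mE) mXY).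
have mDE B : m B = (fine (P E))^-1%:E * P (E `&` (fun w => (X w, Y w)) @^-1` B).
  by rewrite setIC.
have PEV : P E * (fine (P E))^-1%:E = 1.
  by rewrite -{1}(fineK PEfin) -EFinM divff// gt_eqF.
have -> : (mu \x nu) D = m D.
  apply: product_measure_unique => // A B mA mB.
  rewrite mDE muleC; have -> : (fun w => (X w, Y w)) @^-1` (A `*` B) =
    X @^-1` A `&` Y @^-1` B by [].
  by rewrite EXY// muleAC PEV mul1e.
by rewrite mDE muleA PEV mul1e.
Qed.

End joint_law.

Section gamma_sums.
Context d (T : measurableType d) (R : realType) (P : probability T R).
Local Open Scope ereal_scope.
Variables (X : nat -> T -> R) (m : nat) (r : R).
Hypothesis mX : forall i, measurable_fun setT (X i).
Hypothesis r1 : density_law (gamma_pdf r) [set: R] = 1.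
Hypothesis indep : forall A : nat -> set R, (forall i, measurable (A i)) ->
  P (\big[setI/setT]_(1 <= i < m.+1) (X i @^-1` A i)) =
  \prod_(1 <= i < m.+1) density_law (gamma_pdf r) (A i).

(* The sum X_2 + ... + X_(n + 1), with n summands. *)
Let S n w := (\sum_(2 <= j < n.+2) X j w)%R.

Let mS n : measurable_fun setT (S n).
Proof. by apply: measurable_sum. Qed.

Let mXA i (A : set R) : measurable A -> measurable (X i @^-1` A).
Proof. by move=> mA; rewrite -[X in measurable X]setTI; exact: mX. Qed.

Let bigI_measurable (A : nat -> set R) a b : (forall i, measurable (A i)) ->
  measurable (\big[setI/setT]_(a <= i < b) (X i @^-1` A i)).
Proof. by move=> mA; apply: bigsetI_measurable => i _; exact: mXA. Qed.

(* The invariant of the induction: X_1, the sum of the n + 1 variables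
   X_2, ..., X_(n + 2), and the remaining X_i are independent. *)
Let partial_sum_law n : (n.+2 <= m)%N ->
  density_law (gamma_pdf (n.+1%:R * r)) [set: R] = 1 /\
  forall (A : nat -> set R) (C : set R), (forall i, measurable (A i)) ->
    measurable C ->
    P ((X 1%N @^-1` A 1%N `&` S n.+1 @^-1` C) `&`
       \big[setI/setT]_(n.+3 <= i < m.+1) (X i @^-1` A i)) =
    density_law (gamma_pdf r) (A 1%N) *
    density_law (gamma_pdf (n.+1%:R * r)) C *
    \prod_(n.+3 <= i < m.+1) density_law (gamma_pdf r) (A i).
Proof.
elim: n => [|n IH] nm.
  rewrite mul1r; split=> // A C mA mC.
  pose A' i := if i == 2%N then C else A i.
  have mA' i : measurable (A' i) by rewrite /A'; case: ifP.
  have := indep mA'.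
  rewrite big_ltn ?ltnS 1?(leq_trans _ nm)// big_ltn ?ltnS//.
  rewrite [in RHS]big_ltn ?ltnS 1?(leq_trans _ nm)// [in RHS]big_ltn ?ltnS//.
  rewrite /A' /= -/A' setIA muleA.
  have -> : S 1 = X 2%N by apply/funext => w; rewrite /S big_nat1.
  have -> : \big[setI/setT]_(3 <= i < m.+1) (X i @^-1` A' i) =
      \big[setI/setT]_(3 <= i < m.+1) (X i @^-1` A i).
    by apply: eq_big_nat => i /andP[i3 _]; rewrite /A' gtn_eqF.
  move=> ->; congr (_ * _).
  by apply: eq_big_nat => i /andP[i3 _]; rewrite /A' gtn_eqF.
have {IH}[n1 IH] := IH (ltnW nm).
have [] := gamma_law_add n1 r1.
have -> : (n.+1%:R * r + r = n.+2%:R * r)%R.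
  by rewrite -[X in (_ + X)%R]mul1r -mulrDl natr1.
move=> n2 conv; split=> // A C mA mC.
pose E := X 1%N @^-1` A 1%N `&`
  \big[setI/setT]_(n.+4 <= i < m.+1) (X i @^-1` A i).
have mE : measurable E.
  by apply: measurableI; [exact: mXA|exact: bigI_measurable].
have EXY B1 B2 : measurable B1 -> measurable B2 ->
    P (E `&` (S n.+1 @^-1` B1 `&` X n.+3 @^-1` B2)) =
    density_law (gamma_pdf r) (A 1%N) *
    \prod_(n.+4 <= i < m.+1) density_law (gamma_pdf r) (A i) *
    (density_law (gamma_pdf (n.+1%:R * r)) B1 * density_law (gamma_pdf r) B2).
  move=> mB1 mB2.
  pose A' i := if i == n.+3 then B2 else A i.
  have mA' i : measurable (A' i) by rewrite /A'; case: ifP.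
  have := IH A' B1 mA' mB1.
  rewrite big_ltn ?ltnS// [in RHS]big_ltn ?ltnS//.
  have A'1 : A' 1%N = A 1%N by [].
  have A'n : A' n.+3 = B2 by rewrite /A' eqxx.
  rewrite A'1 A'n.
  have -> : \big[setI/setT]_(n.+4 <= i < m.+1) (X i @^-1` A' i) =
      \big[setI/setT]_(n.+4 <= i < m.+1) (X i @^-1` A i).
    by apply: eq_big_nat => i /andP[i3 _]; rewrite /A' gtn_eqF.
  have -> : \prod_(n.+4 <= i < m.+1) density_law (gamma_pdf r) (A' i) =
      \prod_(n.+4 <= i < m.+1) density_law (gamma_pdf r) (A i).
    by apply: eq_big_nat => i /andP[i3 _]; rewrite /A' gtn_eqF.
  move=> H.
  transitivity (P (X 1%N @^-1` A 1%N `&` S n.+1 @^-1` B1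
    `&` (X n.+3 @^-1` B2 `&`
         \big[setI/setT]_(n.+4 <= i < m.+1) (X i @^-1` A i)))).
    by congr (P _); rewrite /E -!setIA; congr (_ `&` _); rewrite setIC -setIA.
  rewrite H -!muleA; congr (_ * _).
  by rewrite [RHS]muleC -muleA.
have PE : P E = density_law (gamma_pdf r) (A 1%N) *
    \prod_(n.+4 <= i < m.+1) density_law (gamma_pdf r) (A i).
  have := EXY setT setT measurableT measurableT.
  by rewrite !preimage_setT setTI setIT n1 r1 !mule1.
have [Q1 Q1E] := density_law_probability (@measurable_gamma_pdf _ _)
  (@gamma_pdf_ge0 _ _) n1.
have [Q2 Q2E] := density_law_probability (@measurable_gamma_pdf _ _)
  (@gamma_pdf_ge0 _ _) r1.
have := @joint_law_product _ _ _ P E (S n.+1) (X n.+3) Q1 Q2 mE (mS _) (mX _).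
rewrite Q1E Q2E => /(_ _ [set z | C (z.1 + z.2)%R]) H.
rewrite setIAC -/E.
have -> : S n.+2 @^-1` C =
    (fun w => (S n.+1 w, X n.+3 w)) @^-1` [set z | C (z.1 + z.2)%R].
  have SE w : S n.+2 w = (S n.+1 w + X n.+3 w)%R.
    by rewrite /S [LHS]big_nat_recr.
  by apply/seteqP; split=> w /=; rewrite SE.
rewrite H ?conv//.
- by rewrite PE muleAC.
- by move=> B1 B2 mB1 mB2; rewrite EXY// PE.
have : measurable_fun [set: R * R] (fun z => z.1 + z.2)%R.
  exact: measurable_funD.
by rewrite -[X in _ -> measurable X]setTI; apply.
Qed.

(** The pair formed by [X 1] and the sum of the other variables has as its law
    the product of the gamma laws of shapes [r] and [(m - 1) * r]. *)
Lemma first_rest_sum_law : (2 <= m)%N ->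
  let k := ((m%:R - 1) * r)%R in
  density_law (gamma_pdf k) [set: R] = 1 /\
  forall D : set (R * R), measurable D ->
    P ((fun w => (X 1%N w, \sum_(2 <= j < m.+1) X j w)%R) @^-1` D) =
    (density_law (gamma_pdf r) \x density_law (gamma_pdf k)) D.
Proof.
move=> m2 /=.
have [n mE] : exists n, m = n.+2 by case: m m2 => [|[|n]]// _; exists n.
have [] := @partial_sum_law n; first by rewrite mE.
have -> : (n.+1%:R = m%:R - 1 :> R)%R by rewrite mE -[in RHS]natr1 addrK.
set k := (_ * r)%R => k1 H; split=> // D mD.
have [Q1 Q1E] := density_law_probability (@measurable_gamma_pdf _ _)
  (@gamma_pdf_ge0 _ _) r1.
have [Q2 Q2E] := density_law_probability (@measurable_gamma_pdf _ _)
  (@gamma_pdf_ge0 _ _) k1.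
have := @joint_law_product _ _ _ P setT (X 1%N) (S n.+1) Q1 Q2 measurableT
  (mX _) (mS _).
rewrite Q1E Q2E => /(_ _ D).
rewrite setTI probability_setT mul1e /S -mE; apply => //.
move=> A B mA mB; rewrite setTI mul1e.
have := H (fun _ => A) B (fun _ => mA) mB.
by rewrite mE !big_geq// setIT mule1.
Qed.
End gamma_sums.

(** * Quantiles *)

Section quantiles.
Context d (T : measurableType d) (R : realType) (P : probability T R).
Variable X : {RV P >-> R}.
Local Open Scope ereal_scope.

(** Right-continuity gives that the value at the quantile is at least [p];
    without atoms the distribution function is also left-continuous, which gives
    the other inequality. *)
Lemma cdf_quantile (p : R) : (0 < p < 1)%R ->
  (forall x, P (X @^-1` [set x]) = 0) ->
  cdf X (inf [set x | p%:E <= cdf X x]) = p%:E.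
Proof.
move=> /andP[p0 p1] noatom.
set A := [set x | p%:E <= cdf X x]; set q := inf A.
have nbhs_gt (y : \bar R) : p%:E < y -> nbhs y [set z | p%:E < z].
  by move=> py; apply: open_nbhs_nbhs; split; [exact: open_ereal_gt_ereal|].
have nbhs_lt (y : \bar R) : y < p%:E -> nbhs y [set z | z < p%:E].
  by move=> py; apply: open_nbhs_nbhs; split; [exact: open_ereal_lt_ereal|].
have [a Aa] : exists a, A a.
  have h : nbhs (1 : \bar R) [set z | p%:E < z].
    by apply: nbhs_gt; rewrite lte_fin.
  have h' : \forall x \near +oo%R, p%:E < cdf X x := cvg_cdfy1 X h.
  by have [a Ha] := filter_ex h'; exists a; exact: ltW.
have lbA : has_lbound A.
  have h : nbhs (0 : \bar R) [set z | z < p%:E].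
    by apply: nbhs_lt; rewrite lte_fin.
  have h' : \forall x \near -oo%R, cdf X x < p%:E := cvg_cdfNy0 X h.
  have [b Hb] := filter_ex h'.
  exists b => x Ax; rewrite leNgt; apply/negP => xb.
  have := le_lt_trans Ax (le_lt_trans (cdf_nondecreasing X (ltW xb)) Hb).
  by rewrite ltxx.
apply/eqP; rewrite eq_le; apply/andP; split; last first.
  rewrite leNgt; apply/negP => qp.
  have H : \forall x \near q^'+, cdf X x < p%:E :=
    @cdf_right_continuous _ _ _ _ X q _ (nbhs_lt _ qp).
  have H' : \forall x \near q^'+, cdf X x < p%:E /\ (q < x)%R.
    by apply: filterI; [exact: H|exact: nbhs_right_gt].
  have [x [xp qx]] : exists x, cdf X x < p%:E /\ (q < x)%R.
    exact: (@filter_ex _ _ (at_right_proper_filter q) _ H').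
  have [s As sx] := inf_lt (ex_intro _ _ Aa) qx.
  have := le_lt_trans As (le_lt_trans (cdf_nondecreasing X (ltW sx)) xp).
  by rewrite ltxx.
have mXA (B : set R) : measurable B -> measurable (X @^-1` B).
  by move=> mB; rewrite -[X in measurable X]setTI; exact: measurable_funPT.
have -> : cdf X q = P (X @^-1` `]-oo, q[%classic).
  rewrite /cdf /distribution /pushforward.
  have -> : X @^-1` `]-oo, q]%classic =
      X @^-1` `]-oo, q[%classic `|` X @^-1` [set q].
    by rewrite -preimage_setU setUitv1.
  rewrite measureU; [|exact: mXA|exact: mXA|].
    by rewrite -[RHS]adde0; congr (_ + _); exact: noatom.
  by apply/seteqP; split=> w //= []; rewrite in_itv/= => + wq; rewrite wq ltxx.
pose F n := X @^-1` `]-oo, (q - n.+1%:R^-1)%R]%classic.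
have FE : X @^-1` `]-oo, q[%classic = \bigcup_n F n.
  apply/seteqP; split=> w /=; rewrite in_itv/=.
    move=> wq; exists (Num.truncn (q - X w)^-1) => //.
    rewrite /F /= in_itv/= lerBrDr -lerBrDl.
    have qw : (0 < q - X w)%R by rewrite subr_gt0.
    by rewrite -[leRHS]invrK lef_pV2 ?posrE ?invr_gt0// ltW// truncnS_gt.
  move=> [n _]; rewrite /F /= in_itv/= => /le_lt_trans; apply.
  by rewrite ltrBlDr ltrDl invr_gt0.
have : P (F n) @[n --> \oo] --> P (\bigcup_n F n).
  apply: nondecreasing_cvg_mu => //.
  - by move=> n; exact: mXA.
  - by apply: bigcup_measurable => n _; exact: mXA.
  move=> n k nk; apply/subsetPset => w.
  rewrite /F /= !in_itv/= => /le_trans; apply.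
  by rewrite lerD2l lerN2 lef_pV2 ?posrE// ler_nat.
rewrite -FE => FP; apply: (cvge_to_le FP); apply: nearW => n.
rewrite leNgt; apply/negP => pF.
have : A (q - n.+1%:R^-1)%R by exact: ltW.
by move=> /(ge_inf lbA); rewrite -/q leNgt ltrBlDr ltrDl invr_gt0 ltr0n.
Qed.
End quantiles.

(** * The Snedecor-Fisher law *)

Lemma measurable_inv (R : realType) :
  measurable_fun [set: R] (fun x : R => x^-1).
Proof.
(* At 0 both sides vanish. *)
rewrite (_ : (fun x : R => _) = fun x => x * (x ^+ 2) `^ (-1)); last first.
  apply/funext => x; rewrite powR_inv1 ?sqr_ge0//.
  have [->|xN0] := eqVneq x 0; first by rewrite invr0 mul0r.
  by rewrite expr2 invfM mulrA divff// mul1r.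
apply: measurable_funM => //.
have mp : measurable_fun [set: R] (fun x : R => x `^ (-1)).
  exact: measurable_powR.
by apply: (measurableT_comp mp); exact: measurable_funX.
Qed.

Lemma density_law_subset1 (R : realType) (f : R -> R) (A : set R) (x : R) :
  A `<=` [set x] -> density_law f A = 0%E.
Proof. exact: integral_Sset1. Qed.

Section snedecor_fisher_law.
Context {R : realType}.
Variables (r k : R).
Hypotheses (r0 : 0 < r) (k0 : 0 < k).
Hypothesis r1 : density_law (gamma_pdf r) [set: R] = 1%E.
Hypothesis k1 : density_law (gamma_pdf k) [set: R] = 1%E.

Let h := fun z : R * R => (k * z.1) / (r * z.2).

Lemma measurable_snedecor_fisher_ratio : measurable_fun [set: R * R] h.
Proof.
apply: measurable_funM; first exact: measurable_funM.
by apply: (measurableT_comp (@measurable_inv R)); exact: measurable_funM.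
Qed.

Local Open Scope ereal_scope.

(** The Snedecor-Fisher law has no atoms: given a nonzero first coordinate, at
    most one value of the second one yields a prescribed ratio. *)
Lemma snedecor_fisher_set1 (x : R) : snedecor_fisher r k [set x] = 0.
Proof.
rewrite /snedecor_fisher /pushforward -/h.
have [Q1 Q1E] := density_law_probability (@measurable_gamma_pdf _ _)
  (@gamma_pdf_ge0 _ _) r1.
have [Q2 Q2E] := density_law_probability (@measurable_gamma_pdf _ _)
  (@gamma_pdf_ge0 _ _) k1.
rewrite -Q1E -Q2E; pose Z := [set 0%R : R] `*` [set: R].
have mZ : measurable Z by exact: measurableX.
have mhx : measurable (h @^-1` [set x]).
  by rewrite -[X in measurable X]setTI; exact: measurable_snedecor_fisher_ratio.
have Z0 : (Q1 \x Q2) Z = 0.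
  transitivity (Q1 [set 0%R] * Q2 setT); first exact: product_measure1E.
  rewrite (_ : Q1 [set 0%R] = 0) ?mul0e// Q1E.
  by apply: (@density_law_subset1 _ _ _ 0%R).
have hZ0 : (Q1 \x Q2) (h @^-1` [set x] `\` Z) = 0.
  rewrite /product_measure1; apply: integral0_eq => y _ /=.
  rewrite Q2E; have [y0|y0] := eqVneq y 0%R.
    rewrite (_ : xsection _ _ = set0); first by rewrite -Q2E measure0.
    apply/seteqP; split=> s //; rewrite /xsection /= inE => -[_ /=].
    by rewrite /Z /= y0; case.
  apply: (@density_law_subset1 _ _ _ (k * y / (r * x))%R) => s.
  rewrite /xsection /= inE => -[+ _]; rewrite /h /= => <-.
  have [->|s0] := eqVneq s 0%R; first by rewrite !(mulr0, invr0).
  by field; rewrite (gt_eqF r0) (gt_eqF k0) y0 s0.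
apply: (@subset_measure0 _ _ _ (Q1 \x Q2) _
  ((h @^-1` [set x] `\` Z) `|` Z)) => //.
- by apply: measurableU => //; exact: measurableD.
- by move=> z hz; have [|] := pselect (Z z); [right|left].
- rewrite -[RHS]hZ0; apply: (@measureU0 _ _ _ (Q1 \x Q2)) => //.
  exact: measurableD.
Qed.
End snedecor_fisher_law.

(** * The transformed sample *)

Section powered_sample.
Context {R : realType} d (T : measurableType d) (P : probability T R).
Variables (m : nat) (r g mu : R) (V : nat -> {RV P >-> R}).
Hypotheses (g0 : g != 0) (mu0 : 0 < mu) (H0 : homogeneity m r g mu V).
Local Open Scope ereal_scope.

Let phi := fun x : R => (mu * x `^ g)%R.

Let mphi : measurable_fun [set: R] phi.
Proof. by apply: measurable_funM => //; exact: measurable_powR. Qed.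

(** The gamma law of shape [r] has mass 1 because it is the law of
    [mu * V 1 `^ g]. *)
Lemma gamma_law_of_homogeneity : (1 <= m)%N ->
  density_law (gamma_pdf r) [set: R] = 1.
Proof.
move=> m1; have [_ /(_ 1%N)] := H0; rewrite leqnn m1 => /(_ isT)[_ law1].
have gen1 : density_law (gen_gamma_pdf r g mu) [set: R] = 1.
  by rewrite -law1// /pushforward preimage_setT probability_setT.
by rewrite -(gen_gamma_power_law g0 mu0 measurableT gen1) preimage_setT.
Qed.

Lemma powered_sample_indep (A : nat -> set R) : (forall i, measurable (A i)) ->
  P (\big[setI/setT]_(1 <= i < m.+1) ((fun w => phi (V i w)) @^-1` A i)) =
  \prod_(1 <= i < m.+1) density_law (gamma_pdf r) (A i).
Proof.
move=> mA; have [indep laws] := H0.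
have mphiA i : measurable (phi @^-1` A i).
  by rewrite -[X in measurable X]setTI; exact: mphi.
pose J := [fset i in index_iota 1 m.+1]%fset.
have JE : perm_eq J (index_iota 1 m.+1).
  apply: uniq_perm; [exact: fset_uniq|exact: iota_uniq|].
  by move=> i; rewrite !inE.
have := indep J (fun i => phi @^-1` A i).
rewrite bigcap_fset (perm_big _ JE)/= [in RHS](perm_big _ JE)/= => ->//;
  last first.
  by move=> i /=; rewrite !inE mem_index_iota ltnS.
apply: eq_big_nat => i i1; have [_ lawi] := laws i i1.
have gen1 : density_law (gen_gamma_pdf r g mu) [set: R] = 1.
  by rewrite -lawi// /pushforward preimage_setT probability_setT.
by rewrite -(gen_gamma_power_law g0 mu0 (mA i) gen1) -lawi.
Qed.

End powered_sample.

Theorem proposition2 (R : realType) (d : measure_display)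
    (T : measurableType d) (P : probability T R)
    (m : nat) (r gamma mu alpha : R) (V : nat -> {RV P >-> R})
    (hm : (2 <= m)%N) (hr : 0 < r) (hgamma : gamma != 0) (hmu : 0 < mu)
    (halpha : 0 < alpha < 1)
    (H0 : homogeneity m r gamma mu V) :
  has_law P (fun w => SR_GG m gamma (fun i => V i w))
    (snedecor_fisher r ((m%:R - 1) * r))
  /\ P [set w | rejects_homogeneity m r gamma alpha (fun i => V i w)]
     = alpha%:E.
have m1 : (1 <= m)%N := ltnW hm.
have mR0 : 0 < m%:R - 1 :> R by rewrite subr_gt0 ltr1n.
set k := (m%:R - 1) * r.
have k0 : 0 < k by rewrite mulr_gt0.
have r1 := gamma_law_of_homogeneity hgamma hmu H0 m1.
pose X i w := mu * V i w `^ gamma.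
have mpow : measurable_fun [set: R] (fun x : R => mu * x `^ gamma).
  by apply: measurable_funM => //; exact: measurable_powR.
have mX i : measurable_fun [set: T] (X i) by exact: (measurableT_comp mpow).
have [k1 joint] :=
  first_rest_sum_law mX r1 (powered_sample_indep hgamma hmu H0) hm.
have mh := @measurable_snedecor_fisher_ratio _ r k.
(* mu cancels, and k / r = m - 1; no case split on a zero denominator is needed,
   since the inverse of the sum of powers is a common factor. *)
have SRE : (fun w => SR_GG m gamma (fun i => V i w)) =
    (fun z : R * R => (k * z.1) / (r * z.2)) \o
    (fun w => (X 1%N w, \sum_(2 <= j < m.+1) X j w)).
  apply/funext => w; rewrite /SR_GG /X /= -mulr_sumr.
  rewrite /k !invfM; move: (\sum_(2 <= j < m.+1) _)^-1 => s.
  by field; rewrite !gt_eqF.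
have mS : measurable_fun [set: T] (fun w => \sum_(2 <= j < m.+1) X j w).
  by apply: measurable_sum.
have SRlaw : has_law P (fun w => SR_GG m gamma (fun i => V i w))
    (snedecor_fisher r k).
  split.
    by rewrite SRE; apply: (measurableT_comp mh); exact: measurable_fun_pair.
  move=> A mA; rewrite SRE /snedecor_fisher /pushforward comp_preimage joint//.
  by rewrite -[X in measurable X]setTI; exact: mh.
split=> //.
case: (SRlaw) => mSR lawSR.
pose Q : {RV P >-> R} := HB.pack (fun w => SR_GG m gamma (fun i => V i w))
  (isMeasurableFun.Build _ _ _ _ _ mSR).
have noatom x : P (Q @^-1` [set x]) = 0%E.
  by rewrite -(snedecor_fisher_set1 hr k0 r1 k1 x) -lawSR.
have a01 : 0 < 1 - alpha < 1.
  by move/andP: halpha => [a0 a1]; rewrite subr_gt0 a1 ltrBlDr ltrDl.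
have qE : quantile (snedecor_fisher r k) (1 - alpha) =
    inf [set x | ((1 - alpha)%:E <= cdf Q x)%E].
  by congr inf; apply/seteqP; split=> x /=; rewrite -lawSR.
have := ccdf_1_cdf Q (quantile (snedecor_fisher r k) (1 - alpha)).
rewrite {2}qE cdf_quantile// -EFinB subKr => <-.
by congr (P _); apply/seteqP; split=> w; rewrite /= in_itv/= andbT.
Qed.
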